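(* Assume $\mathfrak d=\mathfrak c$. Then there exists a countable regular maximal selectively separable space.
   Context: Spaces are non-empty and regular spaces are $T_1$. $\mathfrak c$ is the cardinality of the continuum and $\mathfrak d$ is the dominating number (the minimum cardinality of a family $\mathcal{G}\subset\omega^\omega$ such that every $f\in\omega^\omega$ satisfies $f(n)\le g(n)$ for all but finitely many $n$, for some $g\in\mathcal{G}$). A space is crowded if it has no isolated points. A space is maximal if it is crowded and no strictly stronger (finer) topology on the same set is crowded. $X$ is selectively separable if for every sequence $(D_n:n\in\omega)$ of dense subspaces of $X$ one can pick finite sets $F_n\subset D_n$ so that $\bigcup_{n\in\omega}F_n$ is dense in $X$. *)

(* Defs.v *)
From HB Require Import structures.
From mathcomp Require Import all_boot all_order all_algebra.
From mathcomp Require Import all_classical all_reals all_analysis.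

Set Implicit Arguments.
Unset Strict Implicit.
Unset Printing Implicit Defensive.

Local Open Scope classical_set_scope.
Local Open Scope card_scope.

Definition eventually_le (f g : nat -> nat) : Prop :=
  finite_set [set n | ~~ (f n <= g n)%N].

Definition dominating (G : set (nat -> nat)) : Prop :=
  forall f : nat -> nat, exists2 g, G g & eventually_le f g.

(* There is no type of cardinals, so a cardinal is given by any set [A] having
   it: [A] has cardinality the dominating number when its cardinality is the
   minimum of the cardinalities of dominating families. *)
Definition card_is_dominating_number (U : Type) (A : set U) : Prop :=
  (exists2 G, dominating G & G #= A) /\
  (forall G, dominating G -> A #<= G).

Definition dominating_number_eq_continuum (R : realType) : Prop :=
  card_is_dominating_number [set: R].

Definition crowded (X : topologicalType) : Prop :=
  isolated [set: X] = set0.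

(* [tau : Topological X] is an arbitrary topological structure on the carrier
   of [X], unrelated to the given topology of [X]. *)
Definition maximal_space (X : topologicalType) : Prop :=
  crowded X /\
  ~ exists tau : Topological X,
      let Y : topologicalType := Topological.Pack tau in
      (@open X : set (set X)) `<` (@open Y : set (set X)) /\ crowded Y.

Definition selectively_separable (X : topologicalType) : Prop :=
  forall D : nat -> set X, (forall n, dense (D n)) ->
  exists F : nat -> set X,
    (forall n, finite_set (F n) /\ F n `<=` D n) /\
    dense (\bigcup_n F n).

(* Main.v *)
(** A family of colorings of a countable set makes it a zero-dimensional space,
    the fibres of the colorings being clopen.  Starting from the residues modulo
    the positive integers, colorings are added by a recursion of length
    continuum that keeps the space crowded; before each step its weight is less
    than the continuum, hence less than the dominating number.

    Let [D_n] be dense sets of such a space and [z] a point.  A sequence of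
    neighborhoods shrinking to [z] and a function that the weight is too small
    to dominate give finite sets [L_k] in [D_k] whose union accumulates at [z]
    and nowhere else; so the [D_n] stay dense when finitely many such fans are
    removed.  Painting disjoint fans, one of each color at each point, yields a
    coloring whose fibres are dense and which is injective off a union of finite
    sets [F_n] in [D_n].  Once this coloring is added, that union meets every
    nonempty open set of every later crowded topology, which gives selective
    separability; for a constant sequence it shows that dense sets end up open.
    Sets that are crowded with crowded complement are made clopen along the way.

    In the final space the closure of a crowded set [A] is open, and the union
    of [A] with the complement of its closure is dense, hence open; so [A] is
    open, and a crowded finer topology adds nothing. *)
Require Import Defs.
From HB Require Import structures.
From mathcomp Require Import all_boot all_order all_algebra.
From mathcomp Require Import all_classical all_reals all_analysis.
From mathcomp Require Import ring lra.

Set Implicit Arguments.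
Unset Strict Implicit.
Unset Printing Implicit Defensive.

Local Open Scope classical_set_scope.
Local Open Scope card_scope.

(** * Finite words over a set *)

Lemma set_inj_card_le (T U : Type) (A : set T) (B : set U) (f : T -> U) :
  set_fun A B f -> set_inj A f -> A #<= B.
Proof.
move=> fAB f_inj; have [g] : $|{injfun A >-> B}| by apply/injfunPex; exists f.
exact: inj_card_le g.
Qed.

Lemma countableU (T : Type) (A B : set T) :
  countable A -> countable B -> countable (A `|` B).
Proof.
move=> cA cB; rewrite -bigcup2E; apply: bigcup_countable => // -[|[|n]] _ //=.
Qed.

(* For an infinite [L] there are as many words as elements of [L], and for a
   finite [L] only countably many: comparing a set with [words L] spares the
   arithmetic of infinite cardinals. *)
Definition words (T : eqType) (L : set T) : set (seq T) :=
  [set w : seq T | [set` w] `<=` L].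

Lemma words_cons (T : eqType) (L : set T) x w :
  words L (x :: w) <-> L x /\ words L w.
Proof.
split=> [xwL|[Lx wL] y]; last by rewrite /= inE => /predU1P[->|/wL].
by split=> [|y yw]; apply: xwL; rewrite /= inE ?eqxx // [_ \in w]yw orbT.
Qed.

Lemma words_cat (T : eqType) (L : set T) v w :
  words L v -> words L w -> words L (v ++ w).
Proof. by move=> vL wL x; rewrite /= mem_cat => /orP[/vL|/wL]. Qed.

Lemma wordsS (T : eqType) (L M : set T) : L `<=` M -> words L `<=` words M.
Proof. by move=> LM w /subset_trans; exact. Qed.

Lemma words_bigcup_chain (I : Type) (T : eqType) (D : set I) (L : I -> set T) :
  D !=set0 ->
  (forall i j, D i -> D j -> L i `<=` L j \/ L j `<=` L i) ->
  words (\bigcup_(i in D) L i) `<=` \bigcup_(i in D) words (L i).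
Proof.
move=> [i0 Di0] chain; elim=> [|x w IHw]; first by exists i0.
move=> /words_cons[[i Di Lix] /IHw[j Dj wLj]].
have [ij|ji] := chain i j Di Dj; [exists j|exists i] => //; apply/words_cons.
- by split; first exact: ij.
- by split; last exact: wordsS ji _ wLj.
Qed.

Lemma countable_words (T : eqType) (L : set T) :
  countable L -> countable (words L).
Proof.
move=> /countable_injP[f f_inj].
apply: (@sub_countable _ _ _ [set: seq nat]); last exact: countableP.
apply: (@set_inj_card_le _ _ _ _ (map f)) => // v w /set_mem vL /set_mem wL.
elim: v w vL wL => [|x v IHv] [|y w] //= /words_cons[Lx vL] /words_cons[Ly wL].
by case=> f_xy /IHv->; rewrite // (f_inj x y) ?inE.
Qed.

HB.instance Definition _ (T : choiceType) := isPointed.Build (seq T) [::].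

Lemma card_words_le (T : eqType) (U : pointedType) (L : set T) (M : set U) :
  infinite_set M -> L #<= words M -> words L #<= words M.
Proof.
move=> /infiniteP/pcard_leP/injfunPex[e eM e_inj].
move=> /pcard_leP/injfunPex[f fM f_inj].
(* A prefix code: each block starts with its length. *)
pose code x := e (size (f x)) :: f x.
apply: (@set_inj_card_le _ _ _ _ (fun w => flatten (map code w))).
  elim=> [|x w IHw] //= /words_cons[Lx wL]; rewrite -cat_cons.
  by apply: words_cat (IHw wL); apply/words_cons; split; [exact: eM|exact: fM].
move=> v w /set_mem + /set_mem.
elim: v w => [|x v IHv] [|y w] //= /words_cons[Lx vL] /words_cons[Ly wL].
case=> /e_inj eq_size /eqP; rewrite eqseq_cat; last first.
  by apply: eq_size; exact: in_setT.
by case/andP=> /eqP f_xy /eqP/IHv->; rewrite // (f_inj x y) ?inE.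
Qed.

Lemma card_words_image (T U : eqType) (f : T -> U) (L : set T) :
  words (f @` L) #<= words L.
Proof.
apply: card_le_trans (card_image_le (map f) (words L)).
apply: subset_card_le; elim=> [|y w IHw]; first by exists [::].
move=> /words_cons[[x Lx <-] /IHw[v vL <-]].
by exists (x :: v) => //; apply/words_cons.
Qed.

Lemma card_words_setU (T : pointedType) (N L : set T) :
  countable N -> infinite_set L -> words (N `|` L) #<= words L.
Proof.
move=> /countable_injP[f f_inj] Loo; apply: card_words_le => //.
have [a La] := infinite_setN0 Loo.
pose code x := if x \in L then [:: x] else nseq (f x).+2 a.
apply: (@set_inj_card_le _ _ _ _ code) => [x|x y].
  rewrite /code; case: ifPn => [/set_mem Lx _|_ _]; first by apply/words_cons.
  by move=> y /nseqP[->].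
rewrite /code !inE => NLx NLy; case: ifPn => xL; case: ifPn => yL //.
- by case.
- case=> /(congr1 size); rewrite /= !size_nseq => -[].
  apply: f_inj; apply: mem_set.
    by case: NLx => // /mem_set; rewrite (negPf xL).
  by case: NLy => // /mem_set; rewrite (negPf yL).
Qed.

Section UncountableWords.
Variables (S : Type) (T : pointedType).
Hypothesis uncountableS : ~ countable [set: S].
Implicit Types L M N : set T.

Lemma uncountable_of_card_words L : [set: S] #<= words L -> ~ countable L.
Proof.
move=> SL /countable_words countableL.
exact/uncountableS/sub_countable/countableL.
Qed.

Lemma card_words_trans L M :
  [set: S] #<= words L -> L #<= words M -> [set: S] #<= words M.
Proof.
move=> SL LM; apply: (card_le_trans SL); apply: (card_words_le _ LM) => Mfin.
apply: (uncountable_of_card_words SL); apply: sub_countable LM _.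
exact/countable_words/finite_set_countable.
Qed.

Lemma card_words_setU_countable N L :
  countable N -> [set: S] #<= words (N `|` L) -> [set: S] #<= words L.
Proof.
move=> countableN SNL; apply: (card_le_trans SNL).
apply: card_words_setU => // Lfin; apply: (uncountable_of_card_words SNL).
exact/countableU/finite_set_countable.
Qed.

End UncountableWords.

(** * Well-orders with small initial segments *)

Definition initial_segment (T : Type) (R : rel T) (t : T) : set T :=
  [set u | ~~ R t u].

Section WellOrder.
Variables (T : eqType) (R : rel T).
Hypothesis woR : wochoice.well_order R.

Let wo_chainR : wochoice.wo_chain R predT.
Proof. exact: wochoice.withinW. Qed.

Lemma well_order_total : total R.
Proof. by move=> x y; exact: (wochoice.wo_chainW wo_chainR). Qed.

Lemma well_order_anti : antisymmetric R.
Proof. by move=> x y; exact: (wochoice.wo_chain_antisymmetric wo_chainR). Qed.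

Lemma well_order_min (P : set T) :
  P !=set0 -> exists2 m, P m & forall x, P x -> R m x.
Proof.
move=> [x Px]; have [|m [[Pm m_le] _]] := woR (A := mem P).
  by exists x; exact/mem_set.
by exists m => [|y Py]; [exact/set_mem|apply/m_le/mem_set].
Qed.

Lemma well_order_trans : transitive R.
Proof.
move=> y x z xy yz; have [|m m_in m_le] := @well_order_min [set` [:: x; y; z]].
  by exists x; exact: mem_head.
have mx : R m x by apply: m_le; rewrite /= !inE eqxx.
have my : R m y by apply: m_le; rewrite /= !inE eqxx orbT.
have mz : R m z by apply: m_le; rewrite /= !inE eqxx !orbT.
move: m_in; rewrite /= !inE => /or3P[] /eqP em; subst m => //.
  by rewrite (@well_order_anti x y) ?xy.
by rewrite -(@well_order_anti y z) ?yz.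
Qed.

Lemma well_founded_initial_segment :
  well_founded (fun u t => initial_segment R t u).
Proof.
move=> t; apply: contrapT => t_nacc.
have [|m m_nacc m_le] :=
  @well_order_min [set u | ~ Acc (fun u t => initial_segment R t u) u].
  by exists t.
by apply: m_nacc; constructor => u /negP mu; apply: contrapT => /m_le.
Qed.

Lemma words_initial_segment t : initial_segment R t !=set0 ->
  words (initial_segment R t) `<=`
  \bigcup_(m in initial_segment R t) words [set u | R u m].
Proof.
move=> seg0 w w_seg; apply: words_bigcup_chain => // [x y _ _|].
  by have /orP[xy|yx] := well_order_total x y; [left|right] => u /= ux;
    apply: well_order_trans ux _.
apply: wordsS w w_seg => u ut; exists u => //.
by have := well_order_total u u; rewrite orbb.
Qed.

Variable rk : T -> T.

Definition rank_order : rel T :=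
  fun x y => if rk x == rk y then R x y else R (rk x) (rk y).

Lemma well_order_rank : wochoice.well_order rank_order.
Proof.
apply: wochoice.antisymmetric_well_order => [x y|A [a Aa]].
  rewrite /rank_order eq_sym; case: eqP => [_ /well_order_anti//|rk_neq].
  by move/well_order_anti/esym/rk_neq.
have [|_ [b Ab <-] b_le] := @well_order_min (rk @` [set` A]).
  by exists (rk a), a.
have [|m [Am rk_m] m_le] := @well_order_min [set x | A x /\ rk x = rk b].
  by exists b.
exists m; split=> // x Ax; rewrite /rank_order rk_m.
by case: eqP => [rk_x|_]; [apply: m_le|apply: b_le; exists x].
Qed.

Lemma rank_order_initial_segment t :
  initial_segment rank_order t `<=` [set u | R (rk u) (rk t)].
Proof.
move=> u; rewrite /initial_segment /rank_order /=; case: eqP => [->|_].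
  by have := well_order_total (rk u) (rk u); rewrite orbb.
by have /orP[->|] := well_order_total (rk t) (rk u).
Qed.

End WellOrder.

(* If the points can be coded by words over some initial segment of [R], take
   the least such segment and rank each point by the greatest letter of its
   code: the points ranked up to [x] have codes over a smaller segment. *)
Lemma uncountable_small_segments (T : pointedType) :
  ~ countable [set: T] ->
  exists2 R : rel T, wochoice.well_order R &
    forall t, ~ ([set: T] #<= words (initial_segment R t)).
Proof.
move=> uncountableT; have [R woR] := wochoice.well_ordering_principle T.
have [small|/existsNP[t0 /contrapT large0]] :=
  pselect (forall t, ~ ([set: T] #<= words (initial_segment R t))).
  by exists R.
have [|t large t_le] :=
  @well_order_min _ _ woR [set t | [set: T] #<= words (initial_segment R t)].
  by exists t0.
have [t1 t1t] : initial_segment R t !=set0.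
  apply/set0P/eqP => seg0.
  apply: (uncountable_of_card_words uncountableT large).
  by rewrite seg0; exact: countable0.
have /pcard_leP/injfunPex[f f_words f_inj] := large.
have /choice[rk rkP] x :
    exists m, initial_segment R t m /\ words [set u | R u m] (f x).
  have [|m mt fx_m] := words_initial_segment woR _ (f_words x I).
    by exists t1.
  by exists m.
exists (rank_order R rk); first exact: well_order_rank.
move=> x large_x; have [rkx_t _] := rkP x; move/negP: rkx_t; apply.
apply: t_le.
apply: (card_words_setU_countable uncountableT (countable1 (rk x))).
apply: (card_words_trans uncountableT large_x).
apply: (@set_inj_card_le _ _ _ _ f) => [u ux|u v _ _]; last first.
  by apply: f_inj; exact: in_setT.
have [_] := rkP u; apply: wordsS => v /= vu.
have vx := well_order_trans woR vu (rank_order_initial_segment woR ux).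
have [xv|xv] := boolP (R (rk x) v); last by right.
by left; apply: (well_order_anti woR); rewrite vx.
Qed.

Lemma transfinite_choice (T : Type) (U : pointedType) (lt : T -> T -> Prop)
    (P : set U -> T -> U -> Prop) :
  well_founded lt ->
  (forall t (c : T -> U),
     (forall u, lt u t -> P (c @` [set v | lt v u]) u (c u)) ->
     exists x, P (c @` [set u | lt u t]) t x) ->
  exists c : T -> U, forall t, P (c @` [set u | lt u t]) t (c t).
Proof.
move=> wf_lt P_ex.
pose step t (rec : forall u, lt u t -> U) :=
  get [set x | P [set y | exists u (ut : lt u t), rec u ut = y] t x].
pose c := Fix wf_lt (fun=> U) step.
have c_step t : c t = get [set x | P (c @` [set u | lt u t]) t x].
  rewrite /c Fix_eq => [|{}t f g fg]; last first.
    congr step; apply/functional_extensionality_dep => u.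
    exact/functional_extensionality_dep.
  congr get; apply/funext => x; congr (P _ t x).
  by apply/seteqP; split=> y [u] => [[ut]|ut] <-; [exists u|exists u, ut].
exists c => t; elim/(well_founded_ind wf_lt): t => t IHt.
by rewrite c_step; apply: getPex; exact: P_ex.
Qed.

(** * Sequences of sets and the continuum *)

Lemma uncountable_set_sequences (T : Type) (x0 : T) :
  ~ countable [set: nat -> set T].
Proof.
case/countable_injP=> code code_inj.
pose diag n := exists2 D, code D = n & ~ D n x0.
pose constant_diag n : set T := [set _ | diag n].
have diagP : diag (code constant_diag) <-> ~ diag (code constant_diag).
  split=> [[D code_D]|nd]; last by exists constant_diag.
  by rewrite (code_inj D constant_diag) ?inE.
have not_diag : ~ diag (code constant_diag) by move=> d; exact: (diagP.1 d d).
exact/not_diag/diagP.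
Qed.

Section TernarySeries.
Import Order.TTheory GRing.Theory Num.Theory numFieldNormedType.Exports.
Local Open Scope ring_scope.
Variable R : realType.
Implicit Types x y : nat -> bool.

(* In base 3 a binary digit exceeds everything after it, so that digits can be
   read off from the sum. *)
Definition ternary_term x : R ^nat := fun i => (x i)%:R * 3^-1 ^+ i.

Definition ternary_series x : R := limn (series (ternary_term x)).

Lemma ternary_term_ge0 x i : 0 <= ternary_term x i.
Proof. by rewrite mulr_ge0 ?exprn_ge0 ?invr_ge0. Qed.

Lemma ternary_term_le_geometric x i : ternary_term x i <= geometric 1 3^-1 i.
Proof. by rewrite ler_wpM2r ?exprn_ge0 ?invr_ge0// lern1 leq_b1. Qed.

Lemma norm_third_lt1 : `|3^-1 : R| < 1.
Proof. by rewrite ger0_norm; lra. Qed.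

Lemma is_cvg_ternary_series x : cvgn (series (ternary_term x)).
Proof.
apply: (@series_le_cvg _ _ (geometric 1 3^-1)).
- exact: ternary_term_ge0.
- by move=> i; rewrite /= mul1r exprn_ge0 ?invr_ge0.
- exact: ternary_term_le_geometric.
- exact/is_cvg_geometric_series/norm_third_lt1.
Qed.

Lemma ternary_series_ge0 x : 0 <= ternary_series x.
Proof.
apply: limr_ge; first exact: is_cvg_ternary_series.
by apply: nearW => n; apply: sumr_ge0 => i _; exact: ternary_term_ge0.
Qed.

Lemma ternary_series_le x : ternary_series x <= 3 / 2.
Proof.
apply: limr_le; first exact: is_cvg_ternary_series.
apply: nearW => n; apply: (@le_trans _ _ (series (geometric 1 3^-1) n)).
  by apply: ler_sum => i _; exact: ternary_term_le_geometric.
rewrite (_ : 3 / 2 = 1 / (1 - 3^-1)); last by field.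
by apply: geometric_le_lim norm_third_lt1; lra.
Qed.

Lemma ternary_series_recl x :
  ternary_series x = (x 0%N)%:R + 3^-1 * ternary_series (x \o succn).
Proof.
apply/cvg_lim => //; rewrite -cvg_shiftS.
rewrite [X in X @ _ --> _](_ : _ =
   (fun n => (x 0%N)%:R + 3^-1 * series (ternary_term (x \o succn)) n)).
  by apply: cvgD; [exact: cvg_cst|apply: cvgMr; exact: is_cvg_ternary_series].
apply/funext => n; rewrite /series /= big_nat_recl// /ternary_term.
rewrite expr0 mulr1 mulr_sumr.
by congr (_ + _); apply: eq_bigr => i _; rewrite exprS mulrCA.
Qed.

Lemma ternary_series_eq x y : ternary_series x = ternary_series y ->
  x 0%N = y 0%N /\
  ternary_series (x \o succn) = ternary_series (y \o succn).
Proof.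
rewrite (ternary_series_recl x) (ternary_series_recl y).
have := (ternary_series_ge0 (x \o succn), ternary_series_ge0 (y \o succn)).
have := (ternary_series_le (x \o succn), ternary_series_le (y \o succn)).
by case: (x 0%N); case: (y 0%N) => /= -[? ?] [? ?] ?; split=> //; lra.
Qed.

Lemma ternary_series_inj : injective ternary_series.
Proof.
suff eq_digits n x y : ternary_series x = ternary_series y -> x n = y n.
  by move=> x y xy; apply/funext => n; exact: eq_digits.
by elim: n x y => [|n IHn] x y /ternary_series_eq[// _ /IHn].
Qed.

End TernarySeries.

Lemma card_set_sequences_le_continuum (T : countType) (R : realType) :
  [set: nat -> set T] #<= [set: R].
Proof.
pose digits (D : nat -> set T) k :=
  if unpickle k is Some (n, a) then `[< D n a >] else false.
apply: (@set_inj_card_le _ _ _ _ (fun D => ternary_series R (digits D))) => //.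
move=> D D' _ _ /ternary_series_inj DD'.
apply/funext => n; apply/funext => a; apply/propext; apply: asbool_eq_equiv.
by have := congr1 (@^~ (pickle (n, a))) DD'; rewrite /digits /= !pickleK.
Qed.

(** * Crowded spaces *)

Lemma crowdedP (X : topologicalType) :
  crowded X <-> forall x : X, limit_point [set: X] x.
Proof.
split=> [X_crowded x|limX].
  have := closure_isolated_limit_point [set: X].
  by rewrite X_crowded set0U => <-; exact: subset_closure.
apply/seteqP; split=> // x x_isolated.
have /disj_setPS := disjoint_isolated_limit_point [set: X].
by apply; split; [exact: x_isolated|exact: limX].
Qed.

Lemma limit_pointS (X : topologicalType) (A B : set X) :
  A `<=` B -> limit_point A `<=` limit_point B.
Proof. by move=> AB x Ax U /Ax[y [yx /AB]]; exists y. Qed.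

Lemma limit_point_infinite (X : topologicalType) (A U : set X) x :
  accessible_space X -> limit_point A x -> nbhs x U -> infinite_set (A `&` U).
Proof.
move=> T1 limAx Ux AUfin; have AUx_fin := finite_setD [set x] AUfin.
have [|y [/eqP yx Ay [Uy]]] := limAx (U `&` ~` ((A `&` U) `\ x)); last exact.
apply: filterI => //; apply: open_nbhs_nbhs; split; last by case=> _; exact.
by apply: closed_openC; exact: (accessible_finite_set_closed.1 T1).
Qed.

Lemma closure_limit_point (X : topologicalType) (A : set X) :
  A `<=` limit_point A -> closure A `<=` limit_point (closure A).
Proof.
move=> limA x; rewrite {1}closure_isolated_limit_point => Ax.
by apply: (limit_pointS (@subset_closure _ A)); case: Ax => [/isolatedS/limA|].
Qed.

Lemma open_of_open_closure (X : topologicalType) (A : set X) :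
  (forall D : set X, dense D -> open D) -> open (closure A) -> open A.
Proof.
move=> open_dense oclA.
have -> : A = closure A `&` (A `|` ~` closure A).
  by rewrite setIUr setICr setU0; apply/esym/setIidr; exact: subset_closure.
apply: openI => //; apply: open_dense => U [x Ux] oU.
have [clAx|nclAx] := pselect (closure A x); last first.
  by exists x; split=> //; right.
have [y [Ay Uy]] := clAx U (open_nbhs_nbhs (conj oU Ux)).
by exists y; split=> //; left.
Qed.

Section Crowded.
Variable X : topologicalType.
Hypothesis X_crowded : crowded X.
Implicit Types D U : set X.

Lemma crowded_open_neq U x : open U -> U x -> exists2 y, U y & y <> x.
Proof.
move=> oU Ux; have Ux_nbhs : nbhs x U by exact: open_nbhs_nbhs.
have [y [/eqP yx _ Uy]] := (crowdedP X).1 X_crowded x U Ux_nbhs.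
by exists y.
Qed.

Lemma open_limit_point U : open U -> U `<=` limit_point U.
Proof.
move=> oU x Ux V Vx; have Ux_nbhs : nbhs x U by exact: open_nbhs_nbhs.
have [y [yx _ [Uy Vy]]] := (crowdedP X).1 X_crowded x _ (filterI Ux_nbhs Vx).
by exists y.
Qed.

Lemma dense_limit_point D :
  accessible_space X -> dense D -> forall x, limit_point D x.
Proof.
move=> T1 dD x U; rewrite nbhsE => -[V [oV Vx] VU].
have [y Vy yx] := crowded_open_neq oV Vx.
have [||z [[Vz zx] Dz]] := dD (V `\ x).
- by exists y.
- by apply: openI => //; exact/closed_openC/accessible_closed_set1.
- by exists z; split=> //; [exact/eqP|exact: VU].
Qed.

End Crowded.

(* The members of a crowded finer topology are crowded in the given one. *)
Lemma maximal_of_open_crowded_sets (X : topologicalType) :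
  crowded X -> (forall A : set X, A `<=` limit_point A -> open A) ->
  maximal_space X.
Proof.
move=> X_crowded open_crowded; split=> // -[tau] /=.
set Y := Topological.Pack tau => -[[XY notYX] Y_crowded].
apply: notYX => A oA; apply: open_crowded => x Ax U.
rewrite nbhsE => -[V [/XY oV Vx] VU].
have oAV : open (A `&` V : set Y) by exact: openI.
have [y [Ay Vy] yx] := crowded_open_neq Y_crowded oAV (conj Ax Vx).
by exists y; split; [exact/eqP|exact: Ay|exact: VU].
Qed.

(** * Selections in countable spaces of small character *)

Definition below_dominating_number (U : Type) (A : set U) : Prop :=
  forall G, dominating G -> ~ (G #<= A).

Lemma below_dominating_numberS (U V : Type) (A : set U) (B : set V) :
  A #<= B -> below_dominating_number B -> below_dominating_number A.
Proof. by move=> AB Bd G /Bd GB GA; apply: GB; exact: card_le_trans AB. Qed.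

Lemma undominated_function (U : Type) (A : set U)
    (f : U -> nat -> nat) :
  below_dominating_number A ->
  exists g, forall a, A a -> exists n, f a n <= g n.
Proof.
move=> A_small; have /existsNP[g g_undominated] : ~ dominating (f @` A).
  by move=> /A_small; apply; exact: card_image_le.
exists g => a Aa; apply: contrapT => /forallNP fg; apply: g_undominated.
exists (f a); first by exists a.
rewrite /eventually_le (_ : [set _ | _] = set0)//.
apply/seteqP; split=> // n /=.
by case: leqP => // /ltnW/fg.
Qed.

Definition neighborhood_base (X : topologicalType) (x : X)
    (W : set (set X)) : Prop :=
  W `<=` nbhs x /\ forall A, nbhs x A -> exists2 V, W V & V `<=` A.

Definition small_character (X : topologicalType) : Prop :=
  forall x : X, exists2 W, neighborhood_base x W & below_dominating_number W.

Definition thin (X : topologicalType) (P : set X) : Prop :=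
  forall U : set X, open U -> U !=set0 ->
  exists V : set X, [/\ open V, V !=set0, V `<=` U & finite_set (P `&` V)].

Lemma thin0 (X : topologicalType) : thin (@set0 X).
Proof. by move=> U oU U0; exists U; split; rewrite ?set0I. Qed.

Lemma thinU (X : topologicalType) (P Q : set X) :
  thin P -> thin Q -> thin (P `|` Q).
Proof.
move=> thinP thinQ U oU /(thinP U oU)[V [oV V0 VU PV]].
have [W [oW W0 WV QW]] := thinQ V oV V0; exists W; split=> //.
  exact: subset_trans VU.
rewrite setIUl finite_setU; split=> //.
by apply: sub_finite_set PV; exact: setIS.
Qed.

Lemma dense_setD_thin (X : topologicalType) (D P : set X) :
  accessible_space X -> crowded X -> dense D -> thin P -> dense (D `\` P).
Proof.
move=> T1 X_crowded dD thinP U U0 oU.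
have [V [oV [v Vv] VU PV]] := thinP U oU U0.
have DVoo : infinite_set (D `&` V).
  apply: (@limit_point_infinite _ D V v T1); first exact: dense_limit_point.
  exact: open_nbhs_nbhs.
have [x [[Dx Vx] nPVx]] := infinite_setN0 (infinite_setD DVoo PV).
by exists x; split; [exact: VU|split=> // Px; exact: nPVx].
Qed.

Definition locally_finite_off (X : topologicalType) (z : X) (Q : set X) :
    Prop :=
  forall w, w <> z -> exists2 V, nbhs w V & finite_set (Q `&` V).

Lemma thin_locally_finite_off (X : topologicalType) (z : X) (Q : set X) :
  crowded X -> locally_finite_off z Q -> thin Q.
Proof.
move=> X_crowded Qlf U oU [u Uu].
have [w Uw wu] := crowded_open_neq X_crowded oU Uu.
have [x Ux xz] : exists2 x, U x & x <> z.
  have [uz|] := pselect (u = z); last by exists u.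
  by exists w => //; rewrite -uz.
have [V] := Qlf x xz; rewrite nbhsE => -[W [oW Wx] WV] QV.
exists (U `&` W); split=> //; [exact: openI|by exists x|].
by apply: sub_finite_set QV; apply: setIS => y [_ /WV].
Qed.

Lemma trivIset_coloring (I T : Type) (E : nat -> set T) (h : nat -> I)
    (g : T -> I) :
  trivIset setT E ->
  exists c : T -> I, (forall n x, E n x -> c x = h n) /\
    (forall x, ~ (\bigcup_n E n) x -> c x = g x).
Proof.
move=> tE; have /choice[c cP] x : exists i, (forall n, E n x -> i = h n) /\
    (~ (\bigcup_n E n) x -> i = g x).
  have [[n _ Enx]|nE] := pselect ((\bigcup_n E n) x); last first.
    by exists (g x); split=> // n Enx; case: nE; exists n.
  exists (h n); split=> [m Emx|[]]; last by exists n.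
  by rewrite (tE n m) //; exists x.
exists c; split=> [n x|x]; have [c_on c_off] := cP x; first exact: c_on.
exact: c_off.
Qed.

Definition selects (T : Type) (D : nat -> set T) (c : T -> nat) : Prop :=
  exists2 F : nat -> set T, (forall n, finite_set (F n) /\ F n `<=` D n) &
    set_inj (~` \bigcup_n F n) c.

Lemma selects_dense (X : topologicalType) (D : nat -> set X) (c : X -> nat) :
  crowded X -> (forall i, open (c @^-1` [set i])) -> selects D c ->
  exists F : nat -> set X,
    (forall n, finite_set (F n) /\ F n `<=` D n) /\ dense (\bigcup_n F n).
Proof.
move=> X_crowded oc [F FD c_inj]; exists F; split=> // U [x Ux] oU.
have oUc : open (U `&` c @^-1` [set c x]) by exact: openI.
have [y [Uy cyx] yx] := crowded_open_neq X_crowded oUc (conj Ux erefl).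
have [Fx|nFx] := pselect ((\bigcup_n F n) x); first by exists x.
have [Fy|nFy] := pselect ((\bigcup_n F n) y); first by exists y.
by case: yx; apply: c_inj; rewrite ?inE.
Qed.

Lemma selects_open (X : topologicalType) (D : set X) (c : X -> nat) :
  accessible_space X -> (forall i, open (c @^-1` [set i])) ->
  selects (fun=> D) c -> open D.
Proof.
move=> T1 oc [F FD c_inj]; rewrite openE => x Dx; pose V := c @^-1` [set c x].
have VDfin : finite_set (V `\` D).
  apply: (@card_le_finite _ _ _ [set c x]); last exact: finite_set1.
  apply: (@set_inj_card_le _ _ _ _ c) => [y []//|y y' + + cyy'].
  have off_F a : a \in V `\` D -> a \in ~` (\bigcup_n F n).
    by rewrite !inE => -[_ nDa] [n _ /(FD n).2].
  by move=> /off_F yF /off_F y'F; exact: c_inj.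
apply: (@filterS _ _ _ (V `&` D)); first by move=> y [].
apply: open_nbhs_nbhs; split=> //.
rewrite -setDD setDE; apply: openI; first exact: oc.
by apply: closed_openC; exact: (accessible_finite_set_closed.1 T1).
Qed.

Section Fans.
Variables (X : topologicalType) (code : X -> nat).
Hypothesis code_inj : injective code.

Definition fan (z : X) (D L : nat -> set X) : Prop :=
  [/\ forall k, finite_set (L k) /\ L k `<=` D k,
      closure (\bigcup_k L k) z & locally_finite_off z (\bigcup_k L k)].

Lemma finite_code_le n : finite_set [set x | code x <= n].
Proof.
apply: (@finite_preimage _ _ `I_n.+1) => //.
by move=> x y _ _; exact: code_inj.
Qed.

Lemma shrinking_nbhs_exist (z : X) : hausdorff_space X ->
  exists U : nat -> set X, (forall k, nbhs z (U k)) /\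
    forall w, w <> z ->
      exists V n, nbhs w V /\ forall k, n <= k -> U k `&` V = set0.
Proof.
rewrite open_hausdorff => T2.
have /choice[AB ABP] w : exists AB : set X * set X,
    w <> z -> [/\ nbhs z AB.1, nbhs w AB.2 & AB.1 `&` AB.2 = set0].
  have [wz|/eqP wz] := pselect (w = z); first by exists (setT, setT).
  have [AB [/set_mem Aw /set_mem Bz] [oA oB /eqP AB0]] := T2 w z wz.
  exists (AB.2, AB.1) => _; split; [exact: open_nbhs_nbhs..|].
  by rewrite setIC.
pose near k := [set w | code w <= k] `\ z.
have near_fin k : finite_set (near k) by exact/finite_setD/finite_code_le.
exists (fun k => \bigcap_(w in near k) (AB w).1); split=> [k|w wz].
  have nbhs_near w : near k w -> nbhs z (AB w).1 by move=> [_ /ABP[]].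
  have /finite_fsetP[N nearN] := near_fin k; rewrite nearN in nbhs_near *.
  exact: filter_bigI nbhs_near.
have [_ Vw AB0] := ABP w wz; exists (AB w).2, (code w); split=> // k wk.
by apply/seteqP; split=> // x [/(_ w (conj wk wz)) Ax Bx]; rewrite -AB0.
Qed.

Hypotheses (T2 : hausdorff_space X) (X_small : small_character X).

Lemma fan_exists (z : X) (D : nat -> set X) : (forall k, dense (D k)) ->
  exists L, fan z D L.
Proof.
move=> dD; have [U [Uz U_shrink]] := shrinking_nbhs_exist z T2.
have [W [Wz W_base] W_small] := X_small z.
have /choice[f fP] V : exists f : nat -> X,
    W V -> forall k, [/\ U k (f k), D k (f k) & V (f k)].
  have [WV|] := pselect (W V); last by exists (fun=> z).
  suff /choice[f fP] : forall k, exists x, [/\ U k x, D k x & V x].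
    by exists f.
  move=> k.
  have UVz : (U k `&` V)° z by exact: filterI (Uz k) (Wz V WV).
  have [x [/interior_subset[Ux Vx] Dx]] :=
    dD k _ (ex_intro _ z UVz) (open_interior _).
  by exists x.
(* Being too few to dominate, the choices [f V] are all caught by one bound. *)
have [g g_undominated] :=
  undominated_function (fun V => code \o f V) W_small.
pose L k := [set x | [/\ code x <= g k, U k x & D k x]].
have L_fin k : finite_set (L k).
  by apply: sub_finite_set (finite_code_le (g k)) => x [].
exists L; split=> [k|A /W_base[V WV VA]|w /U_shrink[V [n [Vw UV0]]]].
- by split=> // x [].
- have [k fk] := g_undominated V WV; have [Ufk Dfk Vfk] := fP V WV k.
  by exists (f V k); split; [exists k|exact: VA].
- exists V => //.
  apply: (@sub_finite_set _ _ (\bigcup_(k in `I_n) L k)); last first.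
    by apply: bigcup_finite => // k _.
  move=> x [[k _ Lx] Vx]; exists k => //=; rewrite ltnNge; apply/negP => nk.
  have UVx : (U k `&` V) x by case: Lx.
  by rewrite UV0 in UVx.
Qed.

Hypothesis X_crowded : crowded X.

Lemma disjoint_fans_exist (z : nat -> X) (D : nat -> nat -> set X) :
  (forall n k, dense (D n k)) ->
  exists2 L : nat -> nat -> set X, forall n, fan (z n) (D n) (L n) &
    trivIset setT (fun n => \bigcup_k L n k).
Proof.
move=> dD; have T1 := hausdorff_accessible T2.
have /choice[G GP] (q : nat * set X) : exists L, thin q.2 ->
    fan (z q.1) (fun k => D q.1 k `\` q.2) L.
  have [thinq|] := pselect (thin q.2); last by exists (fun=> set0).
  have [|L Lfan] := @fan_exists (z q.1) (fun k => D q.1 k `\` q.2).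
    by move=> k; exact: dense_setD_thin.
  by exists L.
pose fix P n := if n is m.+1 then P m `|` \bigcup_k G (m, P m) k else set0.
have P_thin n : thin (P n).
  elim: n => [|n IHn]; first exact: thin0.
  apply: thinU => //; have [_ _ lf] := GP (n, P n) IHn.
  exact: thin_locally_finite_off X_crowded lf.
have P_mono : {homo P : m n / m <= n >-> m `<=` n}.
  apply: homo_leq => [Q|Q P' Q'|n]; [exact: subset_refl| |exact: subsetUl].
  exact: subset_trans.
pose L n := G (n, P n).
have LP n k : finite_set (L n k) /\ L n k `<=` D n k `\` P n.
  by have [finL _ _] := GP (n, P n) (P_thin n); exact: finL.
exists L.
  move=> n; have [_ cl lf] := GP (n, P n) (P_thin n); split=> // k.
  by have [fin sub] := LP n k; split=> // x /sub[].
apply: ltn_trivIset => n m mn; apply/seteqP; split=> // x [[k _ Lmx]].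
by case=> j _ /(LP n j).2[_]; apply; apply: (P_mono m.+1 n mn); right; exists k.
Qed.

(* Stage [n], which codes a point [z] and a color [i], paints a fan at [z] with
   [i]; it takes points of [D n], [D n.+1] and so on only, so that finitely many
   points are taken in each [D m].  Unpainted points get their own code. *)
Lemma selecting_coloring (x0 : X) (D : nat -> set X) :
  (forall k, dense (D k)) ->
  exists2 c : X -> nat, forall i, dense (c @^-1` [set i]) & selects D c.
Proof.
move=> dD.
pose stage n : nat * nat := odflt (0, 0) (unpickle n).
pose z n := xget x0 [set x | code x = (stage n).1].
have [L Lfan disjL] :=
  @disjoint_fans_exist z (fun n k => D (n + k)) (fun n k => dD _).
have [c [c_fan c_off]] :=
  trivIset_coloring (fun n => (stage n).2) code disjL.
exists c => [i U [x Ux] oU|].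
  pose n := pickle (code x, i).
  have [zn tn] : z n = x /\ (stage n).2 = i.
    rewrite /z /stage pickleK; split=> //; apply: code_inj.
    by have := xgetPex x0 (ex_intro (fun y => code y = code x) x erefl).
  have [_ + _] := Lfan n; rewrite zn => /(_ U (open_nbhs_nbhs (conj oU Ux))).
  by move=> [y [Ly Uy]]; exists y; split=> //=; rewrite (c_fan n).
have fin_sub n k : finite_set (L n k) /\ L n k `<=` D (n + k).
  by have [LD _ _] := Lfan n; exact: LD.
exists (fun m => \bigcup_(n in `I_m.+1) L n (m - n)) => [m|x y].
  split; first by apply: bigcup_finite => // n _; have [] := fin_sub n (m - n).
  by move=> x [n /= nm /(fin_sub _ _).2]; rewrite subnKC.
have off_fans a : ~ (\bigcup_m \bigcup_(n in `I_m.+1) L n (m - n)) a ->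
  ~ (\bigcup_n \bigcup_k L n k) a.
  apply: contra_not => -[n _ [k _ La]]; exists (n + k) => //.
  by exists n => /=; rewrite ?ltnS ?leq_addr// addKn.
move=> /set_mem/off_fans x_off /set_mem/off_fans y_off.
by rewrite !c_off // => /code_inj.
Qed.

End Fans.

(** * Topologies generated by colorings *)

(* The topology on [T] generated by the fibres of the members of [C]. *)
Definition coloring_space (T : choiceType) (C : set (T -> nat)) : Type := T.

HB.instance Definition _ (T : choiceType) (C : set (T -> nat)) :=
  Choice.copy (coloring_space C) T.

Definition cell (T : choiceType) (s : seq (T -> nat)) (x : T) : set T :=
  [set y | forall c, c \in s -> c y = c x].

Section Cell.
Variable T : choiceType.
Implicit Types (s t : seq (T -> nat)) (x y : T).

Lemma cell_self s x : cell s x x.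
Proof. by []. Qed.

Lemma cell_trans s x y : cell s x y -> cell s y `<=` cell s x.
Proof. by move=> xy z yz c cs; rewrite yz// xy. Qed.

Lemma cell_sym s x y : cell s x y -> cell s y x.
Proof. by move=> xy c cs; rewrite xy. Qed.

Lemma cell_cat s t x : cell (s ++ t) x `<=` cell s x `&` cell t x.
Proof. by move=> y xy; split=> c cs; apply: xy; rewrite mem_cat cs ?orbT. Qed.

Lemma cell1 c x : cell [:: c] x = c @^-1` [set c x].
Proof.
apply/seteqP; split=> y => [xy|cyx d]; first by apply: xy; rewrite mem_head.
by rewrite inE => /eqP->.
Qed.

End Cell.

Definition separating (T : choiceType) (C : set (T -> nat)) : Prop :=
  forall x y, (forall c, C c -> c x = c y) -> x = y.

Section ColoringTopology.
Variables (T : choiceType) (C : set (T -> nat)).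

Let coloring_open (U : set T) :=
  forall x, U x -> exists2 s, words C s & cell s x `<=` U.

Let coloring_openT : coloring_open setT.
Proof. by move=> x _; exists [::]. Qed.

Let coloring_openI : setI_closed coloring_open.
Proof.
move=> A B oA oB x [/oA[s sC sA] /oB[t tC tB]].
exists (s ++ t); first exact: words_cat.
by move=> y /cell_cat[/sA Ay /tB By].
Qed.

Let coloring_open_bigU (I : Type) (f : I -> set T) :
  (forall i, coloring_open (f i)) -> coloring_open (\bigcup_i f i).
Proof.
move=> of_ x [i _ /of_[s sC sf]]; exists s => // y /sf fy; by exists i.
Qed.

HB.instance Definition _ := isOpenTopological.Build (coloring_space C)
  coloring_openT coloring_openI coloring_open_bigU.

Local Notation X := (coloring_space C).

Lemma open_coloringE :
  open = [set U : set X |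
    forall x, U x -> exists2 s, words C s & cell s x `<=` U].
Proof. by []. Qed.

Lemma open_cell s (x : X) : words C s -> open (cell s x : set X).
Proof.
by rewrite open_coloringE => sC y xy; exists s => //; exact: cell_trans.
Qed.

Lemma nbhs_coloringP (x : X) (A : set X) :
  nbhs x A <-> exists2 s, words C s & cell s x `<=` A.
Proof.
rewrite nbhsE; split=> [[V [+ Vx] VA]|[s sC sA]].
  rewrite open_coloringE => /(_ x Vx)[s sC sV].
  by exists s => //; exact: subset_trans VA.
by exists (cell s x) => //; split; [exact: open_cell|exact: cell_self].
Qed.

Lemma nbhs_cell s (x : X) : words C s -> nbhs x (cell s x).
Proof. by move=> sC; apply/nbhs_coloringP; exists s. Qed.

Lemma open_fibre c i : C c -> open (c @^-1` [set i] : set X).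
Proof.
rewrite open_coloringE => Cc x <-; exists [:: c]; first exact/words_cons.
by rewrite cell1.
Qed.

Lemma coloring_space_regular : regular_space X.
Proof.
move=> x U /nbhs_coloringP[s sC sU].
exists (cell s x); first exact: nbhs_cell.
move=> y /(_ (cell s y) (nbhs_cell y sC))[z [xz yz]].
by apply: sU; apply: cell_trans xz _ _; exact: cell_sym.
Qed.

Lemma coloring_space_hausdorff : separating C -> hausdorff_space X.
Proof.
move=> C_sep x y xy; apply: C_sep => c Cc.
have [z [<- <-]] : c @^-1` [set c x] `&` c @^-1` [set c y] !=set0.
  by apply: xy; apply: open_nbhs_nbhs; split=> //; exact: open_fibre.
by [].
Qed.

Lemma coloring_space_small_character :
  below_dominating_number (words C) -> small_character X.
Proof.
move=> C_small x; exists [set cell s x | s in words C].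
  split=> [_ [s sC <-]|A /nbhs_coloringP[s sC sA]]; first exact: nbhs_cell.
  by exists (cell s x) => //; exists s.
exact: below_dominating_numberS (card_image_le _ _) C_small.
Qed.

End ColoringTopology.

Section CrowdedColorings.
Variable T : choiceType.
Implicit Types (C : set (T -> nat)) (c : T -> nat).

Lemma coloring_denseS C C' (D : set T) : C `<=` C' ->
  dense (D : set (coloring_space C')) -> dense (D : set (coloring_space C)).
Proof.
move=> CC' dD U U0 oU; apply: dD => //.
move: oU; rewrite !open_coloringE => oU x /oU[s sC sU].
by exists s => //; exact: wordsS sC.
Qed.

Lemma coloring_limit_pointS C C' (A : set T) : C `<=` C' ->
  limit_point (A : set (coloring_space C')) `<=`
  limit_point (A : set (coloring_space C)).
Proof.
move=> CC' x limA U /nbhs_coloringP[s sC sU]; apply: limA.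
by apply/nbhs_coloringP; exists s => //; exact: wordsS sC.
Qed.

Definition crowded_fibres C c : Prop :=
  forall x, limit_point (c @^-1` [set c x] : set (coloring_space C)) x.

Lemma crowded_fibresS C C' c :
  C `<=` C' -> crowded_fibres C' c -> crowded_fibres C c.
Proof. by move=> CC' cr x; exact: coloring_limit_pointS CC' _ (cr x). Qed.

Lemma crowded_coloring_spaceS C C' :
  C `<=` C' -> crowded (coloring_space C') -> crowded (coloring_space C).
Proof.
move=> CC' /crowdedP cr; apply/crowdedP => x.
exact: coloring_limit_pointS CC' _ (cr x).
Qed.

Lemma crowded_coloring_spaceU1 C c :
  crowded_fibres C c -> crowded (coloring_space (c |` C)).
Proof.
move=> cr; apply/crowdedP => x U /nbhs_coloringP[s sC sU].
have sC' : words C [seq d <- s | d != c].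
  by move=> d /=; rewrite mem_filter => /andP[/eqP dc /sC[]].
have [y [yx cyx xy]] := cr x _ (@nbhs_cell T C _ x sC').
exists y; split=> //; apply: sU => d ds; have [->//|dc] := eqVneq d c.
by apply: xy; rewrite mem_filter dc.
Qed.

Lemma crowded_coloring_space_bigcup (I : Type) (D : set I)
    (C : I -> set (T -> nat)) :
  D !=set0 -> (forall i j, D i -> D j -> C i `<=` C j \/ C j `<=` C i) ->
  (forall i, D i -> crowded (coloring_space (C i))) ->
  crowded (coloring_space (\bigcup_(i in D) C i)).
Proof.
move=> D0 chain cr; apply/crowdedP => x U /nbhs_coloringP[s sC sU].
have [i Di sCi] := words_bigcup_chain D0 chain sC.
have [y [yx _ xy]] := (crowdedP _).1 (cr i Di) x _ (@nbhs_cell T (C i) _ x sCi).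
by exists y; split=> //; exact: sU.
Qed.

End CrowdedColorings.

(** * Saturated families of colorings *)

Definition indicator (T : Type) (A : set T) (x : T) : nat := `[< A x >].

Definition saturated (T : choiceType) (C : set (T -> nat)) : Prop :=
  [/\ separating C, crowded (coloring_space C),
      forall D : nat -> set (coloring_space C), (forall n, dense (D n)) ->
        exists2 c, C c & selects D c &
      forall A : set T, crowded_fibres C (indicator A) -> C (indicator A)].

Section SaturatedExtension.
Variables (T : countType) (x0 : T) (B : set (T -> nat)).
Hypothesis B_countable : countable B.
Hypothesis B_separating : separating B.
Hypothesis B_crowded : crowded (coloring_space B).
Hypothesis dominating_large :
  forall G, dominating G -> [set: nat -> set T] #<= G.

(* A sequence whose terms are not all dense stands for its initial term, to be
   made clopen if it and its complement are crowded. *)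
Definition handles (C : set (T -> nat)) (D : nat -> set T) (c : T -> nat) :
    Prop :=
  let all_dense := forall n, dense (D n : set (coloring_space C)) in
  [/\ crowded_fibres C c, all_dense -> selects D c &
      ~ all_dense -> crowded_fibres C (indicator (D 0)) -> c = indicator (D 0)].

Lemma handles_exists (C : set (T -> nat)) (D : nat -> set T) :
  separating C -> crowded (coloring_space C) ->
  below_dominating_number (words C) -> exists c, handles C D c.
Proof.
move=> /coloring_space_hausdorff C_T2 C_crowded.
move=> /coloring_space_small_character C_small.
rewrite /handles.
have [dD|ndD] := pselect (forall n, dense (D n : set (coloring_space C))).
  have [c cd cD] := @selecting_coloring (coloring_space C) (@pickle T)
    (pcan_inj pickleK) C_T2 C_small C_crowded x0 D dD.
  exists c; split=> // x.
  exact: (@dense_limit_point (coloring_space C) C_crowded _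
    (hausdorff_accessible C_T2) (cd _)).
have [D0|nD0] := pselect (crowded_fibres C (indicator (D 0))).
  by exists (indicator (D 0)); split.
exists (fun=> 0); split=> // x; rewrite (_ : _ @^-1` _ = setT).
  exact: (crowdedP _).1.
exact/seteqP.
Qed.

Section Recursion.
Variables (I : pointedType) (R : rel I) (c : I -> T -> nat).
Hypothesis woR : wochoice.well_order R.

Lemma crowded_coloring_space_transfinite (L : set I) :
  (forall u, L u -> crowded_fibres (B `|` c @` initial_segment R u) (c u)) ->
  crowded (coloring_space (B `|` c @` L)).
Proof.
move=> cr; have [->|/set0P L0] := eqVneq L set0.
  by rewrite image_set0 setU0.
pose C u := c u |` (B `|` c @` initial_segment R u).
have C_mono u v : R u v -> C u `<=` C v.
  move=> uv d [->|[Bd|[w uw <-]]]; [|by right; left|right; right].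
    have [->|uv_neq] := eqVneq u v; first by left.
    right; right; exists u => //; apply: contra_neqN uv_neq => vu.
    by apply: (well_order_anti woR); rewrite uv vu.
  by exists w => //; apply: contra uw; exact: well_order_trans uv.
apply: (@crowded_coloring_spaceS _ _ (\bigcup_(u in L) C u)).
  move=> d [Bd|[u Lu <-]]; last by exists u => //; left.
  by have [u Lu] := L0; exists u => //; right; left.
apply: crowded_coloring_space_bigcup => // [u v _ _|u /cr]; last first.
  exact: crowded_coloring_spaceU1.
by have /orP[/C_mono|/C_mono] := well_order_total woR u v; [left|right].
Qed.

End Recursion.

Lemma separating_setU (C : set (T -> nat)) : separating (B `|` C).
Proof. by move=> x y xy; apply: B_separating => b Bb; apply: xy; left. Qed.

Lemma handling_family_exists :
  exists (R : rel (nat -> set T)) (c : (nat -> set T) -> T -> nat),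
    wochoice.well_order R /\
    forall D, handles (B `|` c @` initial_segment R D) D (c D).
Proof.
have uncountable_tasks := uncountable_set_sequences x0.
have [R woR small_segments] := uncountable_small_segments uncountable_tasks.
have [|c cP] := @transfinite_choice _ _ _ (fun past => handles (B `|` past))
    (well_founded_initial_segment woR); last by exists R, c.
move=> D c cP; apply: handles_exists; first exact: separating_setU.
  by apply: (crowded_coloring_space_transfinite woR) => D' /cP[].
move=> G /dominating_large G_large G_small; apply: (small_segments D).
apply: card_le_trans (card_words_image c _).
apply: (card_words_setU_countable uncountable_tasks B_countable).
exact: card_le_trans G_small.
Qed.

Lemma saturated_extension : exists2 C, saturated C & B `<=` C.
Proof.
have [R [c [woR cP]]] := handling_family_exists.
have past_sub D : B `|` c @` initial_segment R D `<=` B `|` range c.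
  by apply: setUS; exact: image_subset.
exists (B `|` range c); last exact: subsetUl.
split.
- exact: separating_setU.
- by apply: (crowded_coloring_space_transfinite woR) => D _; have [] := cP D.
- move=> D dD; exists (c D); first by right; exists D.
  have [_ cD _] := cP D; apply: cD => n.
  exact: coloring_denseS (past_sub D) (dD n).
- move=> A A_crowded; pose D n := if n is 0 then A else set0.
  have [_ _ cD] := cP D; right; exists D => //; apply: cD.
    by move=> /(_ 1 setT)[||x []//]; [exists x0|exact: openT].
  exact: crowded_fibresS (past_sub D) A_crowded.
Qed.

End SaturatedExtension.

Section SaturatedSpace.
Variables (T : choiceType) (C : set (T -> nat)).
Hypothesis C_saturated : saturated C.

Local Notation X := (coloring_space C).

Lemma saturated_accessible : accessible_space X.
Proof.
by have [/coloring_space_hausdorff/hausdorff_accessible] := C_saturated.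
Qed.

Lemma saturated_dense_open (D : set X) : dense D -> open D.
Proof.
move=> dD; have [_ _ C_selects _] := C_saturated.
have [c Cc cD] := C_selects (fun=> D) (fun=> dD).
by apply: selects_open saturated_accessible _ cD => i; exact: open_fibre.
Qed.

Lemma saturated_closure_open (A : set X) :
  A `<=` limit_point A -> open (closure A).
Proof.
move=> limA; have [_ X_crowded _ C_indicators] := C_saturated.
have fibreE x : indicator (closure A) @^-1` [set indicator (closure A) x] =
    if `[< closure A x >] then closure A else ~` closure A.
  by apply/seteqP; split=> y; rewrite /indicator /=; do 2!case: asboolP.
have clA_C : C (indicator (closure A)).
  apply: C_indicators => x; rewrite fibreE; case: asboolP => [clAx|nclAx].
    exact: closure_limit_point.
  by apply: open_limit_point => //; exact/closed_openC/closed_closure.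
have -> : closure A = indicator (closure A) @^-1` [set 1].
  by apply/seteqP; split=> x; rewrite /indicator /=; case: asboolP.
exact: open_fibre.
Qed.

Lemma saturated_maximal : maximal_space X.
Proof.
have [_ X_crowded _ _] := C_saturated.
apply: maximal_of_open_crowded_sets => // A limA.
apply: open_of_open_closure; first exact: saturated_dense_open.
exact: saturated_closure_open.
Qed.

Lemma saturated_selectively_separable : selectively_separable X.
Proof.
move=> D dD; have [_ X_crowded C_selects _] := C_saturated.
have [c Cc cD] := C_selects D dD.
by apply: selects_dense X_crowded _ cD => i; exact: open_fibre.
Qed.

End SaturatedSpace.

(** * Residues *)

Definition residue (d x : nat) : nat := x %% d.+1.

Lemma residues_separating : separating (range residue).
Proof.
move=> x y xy; have := xy _ (imageT residue (maxn x y)).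
by rewrite /residue !modn_small ?ltnS ?leq_maxl ?leq_maxr.
Qed.

Lemma residues_crowded : crowded (coloring_space (range residue)).
Proof.
have progression s : words (range residue) s ->
    exists2 m, 0 < m & forall x n, m %| n -> cell s x (x + n).
  elim: s => [|c s IHs]; first by exists 1.
  move=> /words_cons[[d _ <-] /IHs[m m0 sm]].
  exists (d.+1 * m) => [|x n dvd_n e]; first by rewrite muln_gt0.
  rewrite inE => /predU1P[->|].
    rewrite /residue -modnDmr.
    by rewrite (eqP (dvdn_trans (dvdn_mulr _ _) dvd_n)) ?addn0.
  by apply: sm; exact: dvdn_trans (dvdn_mull _ _) dvd_n.
apply/crowdedP => x U /nbhs_coloringP[s /progression[m m0 sm] sU].
exists (x + m); split=> //; last exact/sU/sm.
by rewrite -[X in _ != X]addn0 eqn_add2l -lt0n.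
Qed.

Theorem theorem67 (R : realType) (hdc : dominating_number_eq_continuum R) :
  exists X : topologicalType,
    [set: X] !=set0 /\ countable [set: X] /\
    regular_space X /\ accessible_space X /\
    maximal_space X /\ selectively_separable X.
Proof.
have dominating_large G : dominating G -> [set: nat -> set nat] #<= G.
  by move/hdc.2; exact/card_le_trans/card_set_sequences_le_continuum.
have residues_countable : countable (range residue).
  exact: card_le_trans (card_image_le _ _) (countableP _).
have [C C_saturated _] := saturated_extension 0 residues_countable
  residues_separating residues_crowded dominating_large.
exists (coloring_space C); do ! split.
- by exists 0.
- exact: (@countableP nat).
- exact: coloring_space_regular.
- exact: saturated_accessible.
- exact: (saturated_maximal C_saturated).1.
- exact: (saturated_maximal C_saturated).2.
- exact: saturated_selectively_separable.
Qed.
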